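(* Let $t,u\ge 1$ be positive integers with $t<u$ and $\gcd(t,u)=1$. Suppose that $$\frac{t}{u} = [b_1,1,b_2,1,\ldots,b_m,1]$$ for some integers $b_1,\ldots,b_m\ge 1$ (where $m\ge 1$). Then there exists a simple planar graph $G=(V,E)$ such that $$\tau(G)=t \quad\text{and}\quad |V| = b_2+\cdots+b_m+2.$$
   Context: Graphs are finite; a graph is simple if it has no loops or multiple edges. $\tau(G)$ denotes the number of spanning trees of $G$. For positive integers $a_1,\ldots,a_\ell$, $[a_1,\ldots,a_\ell]$ denotes the continued fraction $$[a_1,\ldots,a_\ell] = \cfrac{1}{a_1+\cfrac{1}{\ddots+\frac{1}{a_\ell}}}.$$ Thus $[b_1,1,b_2,1,\ldots,b_m,1]$ has $2m$ partial quotients, with every even-indexed one equal to $1$. *)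

(* Defs.v *)
From mathcomp Require Import all_boot all_order all_algebra.
From mathcomp Require Import all_classical all_reals all_analysis.
Import Order.TTheory GRing.Theory Num.Theory.
Import numFieldNormedType.Exports.

Set Implicit Arguments.
Unset Strict Implicit.
Unset Printing Implicit Defensive.

Local Open Scope ring_scope.

(* The value 0 on the empty sequence makes cfrac [:: a] = 1 / a. *)
Fixpoint cfrac (s : seq nat) : rat :=
  if s is a :: s' then (a%:R + cfrac s')^-1 else 0.

Record sgraph := SGraph {
  vertex :> finType;
  adj : rel vertex;
  adj_sym : symmetric adj;
  adj_irrefl : irreflexive adj
}.

Definition edges (G : sgraph) : {set {set G}} :=
  ([set [set p.1; p.2] | p : G * G & adj p.1 p.2])%SET.

Section SpanningTrees.
Variables (G : sgraph) (T : {set {set G}}).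

Definition edge_rel : rel G := fun x y => ([set x; y])%SET \in T.

Definition connected_edges : Prop := forall x y : G, connect edge_rel x y.

(* As edge_rel is symmetric, [:: x; y] is an edge_rel-cycle for every edge xy,
   so only the cycles with at least three vertices count. *)
Definition acyclic_edges : Prop :=
  forall c : seq G, ucycle edge_rel c -> (size c < 3)%N.

Definition spanning_tree : Prop :=
  [/\ T \subset edges G, connected_edges & acyclic_edges].

End SpanningTrees.

Definition tau (G : sgraph) : nat :=
  #|[pred T : {set {set G}} | `[< spanning_tree T >] ]|.

Definition is_arc (R : realType) (A : set (R * R)) (p q : R * R) : Prop :=
  exists g : R -> R * R,
    [/\ ({within `[0, 1], continuous g})%classic,
        {in `[0, 1] &, injective g},
        g 0 = p, g 1 = q & A = (g @` `[0, 1])%classic].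

Definition planar (R : realType) (G : sgraph) : Prop :=
  exists (pt : G -> R * R) (arc : {set G} -> set (R * R)),
    [/\ injective pt,
        forall x y : G, adj x y -> is_arc (arc [set x; y]%SET) (pt x) (pt y),
        forall (e : {set G}) (v : G), e \in edges G -> arc e (pt v) -> v \in e
      & forall e f : {set G}, e \in edges G -> f \in edges G -> e != f ->
          forall z, arc e z -> arc f z ->
            exists v : G, [/\ v \in e, v \in f & z = pt v]].

(* Main.v *)
Require Import Defs.
From mathcomp Require Import all_boot all_order all_algebra.
From mathcomp Require Import all_classical all_reals all_analysis.
From mathcomp Require Import zify ring lra.
Import Order.TTheory GRing.Theory Num.Theory.
Import numFieldNormedType.Exports.

(** The graph is a partial fan: a path with vertices 0, ..., n (the rim), and a
    hub [None] joined to the rim vertex n and to some of the others.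

    Let t be the number of spanning trees of such a graph, and f the number of
    its spanning forests with two components that separate the hub from the rim
    vertex 0.  A new vertex attached to the front of the rim changes (t, f) into
    (t, t + f); joining it to the hub as well changes (t, f) into
    (t + (t + f), t + f) ([fan_counts]).  On the other side, putting [b, 1] in
    front of a continued fraction of value p / q gives
    (p + q) / (b (p + q) + q) ([cfrac_step]).  With t = p + q and f = q, this is
    what b new rim vertices do when only the last of them is joined to the hub
    ([fan_counts_blocks]).  The start p / q = 0 / 1, t = f = 1 is a single edge
    from the hub to the rim.  Hence the fan made of the blocks b_m, ..., b_2 has
    p + q spanning trees and b_2 + ... + b_m + 2 vertices, where p / q is the
    value of [b_2, 1, ..., b_m, 1]; and p + q is the numerator of the given
    fraction, as all the fractions that arise are reduced
    ([cfrac_pair_coprime]).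

    The count of spanning trees rests on a description of them: a set of edges
    of the fan consists of spokes (from the hub) and links (along the rim); the
    links cut the rim into segments, and the set is a spanning tree exactly when
    each segment carries exactly one spoke ([fan_spanning_tree]).  This
    condition can be checked while the rim is read from one end to the other
    ([segment_treeS], [segment_forestS]), which gives the recursion above
    ([count_subfans], [tau_fan]).

    For planarity, the rim is placed on the horizontal axis and the hub above
    it, and all the edges are drawn straight ([fan_planar]). *)

Set Implicit Arguments.
Unset Strict Implicit.
Unset Printing Implicit Defensive.

Local Open Scope nat_scope.

(** * Edge sets of symmetric relations *)

Definition edge_set (V : finType) (e : rel V) : {set {set V}} :=
  ([set [set p.1; p.2] | p : V * V & e p.1 p.2])%SET.

Lemma set2_inj (V : finType) (x y a b : V) :
  ([set x; y] = [set a; b])%SET -> (x = a /\ y = b) \/ (x = b /\ y = a).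
Proof.
move=> E.
have := set21 x y; rewrite E !inE => /orP[] /eqP xa; [left|right].
- split=> //; have := set22 x y; rewrite E !inE => /orP[] /eqP // ya.
  by have := set22 a b; rewrite -E !inE xa ya orbb => /eqP.
- split=> //; have := set22 x y; rewrite E !inE => /orP[] /eqP // ya.
  by have := set21 a b; rewrite -E !inE xa ya orbb => /eqP.
Qed.

Lemma mem_edge_set (V : finType) (e : rel V) (x y : V) :
  symmetric e -> (([set x; y])%SET \in edge_set e) = e x y.
Proof.
move=> e_sym; apply/imsetP/idP => [[[a b]] /=|exy]; last first.
  by exists (x, y); rewrite ?inE.
rewrite inE /= => eab /set2_inj[] [-> ->] //; by rewrite e_sym.
Qed.

(** * Spokes on the segments of a path *)

Section Segments.
Variables (n : nat) (spoke link : nat -> bool).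

(** [link k] stands for the edge from k to k+1, so for j <= i the condition is
    void: [linked] is a transitive relation whatever the order of its arguments,
    and [joined], its symmetric part, says that the path from the smaller to the
    larger vertex is present. *)
Definition linked i j := forall k, i <= k < j -> link k.
Definition joined i j := linked i j /\ linked j i.
Definition grounded i := exists j, [/\ j <= n, spoke j & joined i j].
Definition one_spoke :=
  forall i j, i < j <= n -> spoke i -> spoke j -> ~ linked i j.

Lemma linked_geq i j : j <= i -> linked i j.
Proof. by move=> ji k; lia. Qed.

Lemma linked_refl i : linked i i.
Proof. exact: linked_geq. Qed.

Lemma linked_trans i j k : linked i j -> linked j k -> linked i k.
Proof.
move=> ij jk l /andP[il lk]; case: (leqP j l) => jl.
  by apply: jk; rewrite jl.
by apply: ij; rewrite il.
Qed.

Lemma joined_refl i : joined i i.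
Proof. by split; apply: linked_refl. Qed.

Lemma joined_sym i j : joined i j -> joined j i.
Proof. by case. Qed.

Lemma joined_trans i j k : joined i j -> joined j k -> joined i k.
Proof.
by move=> [ij ji] [jk kj]; split; [apply: linked_trans jk | apply: linked_trans ji].
Qed.

Lemma joinedS i : joined i i.+1 <-> link i.
Proof.
split=> [[ii _]|li]; first by apply: ii; rewrite leqnn ltnS leqnn.
split=> k; last by lia.
by rewrite ltnS -eqn_leq => /eqP <-.
Qed.

Lemma grounded_joined i j : joined i j -> grounded j -> grounded i.
Proof.
by move=> ij [k [kn sk jk]]; exists k; split=> //; apply: joined_trans jk.
Qed.

Definition segment_tree := one_spoke /\ (forall i, i <= n -> grounded i).
(** The open condition: the segment of the vertex 0 still lacks a spoke, while
    each other segment has exactly one. *)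
Definition segment_forest :=
  [/\ one_spoke, ~ grounded 0
    & forall i, i <= n -> grounded i \/ joined 0 i].

End Segments.

Section Step.
Variables (n : nat) (spoke link : nat -> bool).
Let spoke' i := spoke i.+1.
Let link' i := link i.+1.

Lemma linkedSS i j : linked link i.+1 j.+1 <-> linked link' i j.
Proof.
split=> H k; first by move=> ikj; apply: H; rewrite !ltnS.
by case: k => // k ikj; apply: H; rewrite !ltnS in ikj.
Qed.

Lemma linked0S j : linked link 0 j.+1 <-> link 0 /\ linked link' 0 j.
Proof.
split=> [H|[l0 H]].
  by split; [apply: H | move=> k kj; apply: H].
by case=> // k kj; apply: H.
Qed.

Lemma joinedSS i j : joined link i.+1 j.+1 <-> joined link' i j.
Proof. by rewrite /joined !linkedSS. Qed.

Lemma joined0S j : joined link 0 j.+1 <-> link 0 /\ joined link' 0 j.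
Proof.
split=> [[/linked0S[l0 lj] _]|[l0 [lj _]]]; last first.
  by split; [apply/linked0S | apply: linked_geq].
by split=> //; split=> //; apply: linked_geq.
Qed.

Lemma grounded0S :
  grounded n.+1 spoke link 0 <->
  spoke 0 \/ (link 0 /\ grounded n spoke' link' 0).
Proof.
split=> [[[|j] [jn sj]]|[s0|[l0 [j [jn sj lj]]]]].
- by left.
- by move=> /joined0S[l0 lj]; right; split=> //; exists j.
- by exists 0; split=> //; apply: joined_refl.
- by exists j.+1; split=> //; apply/joined0S.
Qed.

Lemma groundedSS i :
  grounded n.+1 spoke link i.+1 <->
  grounded n spoke' link' i \/ [/\ spoke 0, link 0 & joined link' 0 i].
Proof.
split=> [[[|j] [jn sj]]|[[j [jn sj lj]]|[s0 l0 li]]].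
- by move=> /joined_sym/joined0S[l0 li]; right.
- by move=> /joinedSS lj; left; exists j.
- by exists j.+1; split=> //; apply/joinedSS.
- by exists 0; split=> //; apply/joined_sym/joined0S.
Qed.

Lemma one_spokeS :
  one_spoke n.+1 spoke link <->
  one_spoke n spoke' link' /\
  (spoke 0 -> link 0 -> ~ grounded n spoke' link' 0).
Proof.
split=> [H|[H H0]].
  split=> [i j ij si sj /linkedSS|s0 l0 [j [jn sj [lj _]]]]; first exact: H.
  by apply: (H 0 j.+1) => //; apply/linked0S.
case=> [|i] [//|j] ij si sj; last by move/linkedSS; apply: H.
move=> /linked0S[l0 lj]; apply: H0 => //; exists j; split=> //.
by split=> //; apply: linked_geq.
Qed.

(** Removing the vertex 0 of the path: if it is linked to 1, its spoke has to be
    the only one of the enlarged segment; if it is not linked, it is a segment of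
    its own and needs a spoke. *)
Lemma segment_treeS :
  segment_tree n.+1 spoke link <->
  (if link 0 then if spoke 0 then segment_forest n spoke' link'
                  else segment_tree n spoke' link'
   else spoke 0 /\ segment_tree n spoke' link').
Proof.
rewrite /segment_tree one_spokeS.
have grE : (forall i, i <= n.+1 -> grounded n.+1 spoke link i) <->
  (spoke 0 \/ link 0 /\ grounded n spoke' link' 0) /\
  (forall i, i <= n -> grounded n spoke' link' i \/
     [/\ spoke 0, link 0 & joined link' 0 i]).
  split=> [H|[H0 H] [|i] ilen].
  - by split=> [|i ilen]; [apply/grounded0S/H | apply/groundedSS/H].
  - exact/grounded0S.
  - by apply/groundedSS/H.
rewrite grE; case: (link 0); case: (spoke 0) => /=.
- split=> [[[os ng] [_ H]]|[os ng H]].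
    by split=> // [|i /H[|[]]]; [apply: ng | left | right].
  split; first by split.
  by split; [left | move=> i /H[]; [left | right]].
- split=> [[[os _] [_ H]]|[os H]].
    by split=> // i /H[|[]].
  by split=> //; split=> [|i /H]; [right; split=> //; exact: H | left].
- split=> [[[os _] [_ H]]|[_ [os H]]].
    by split=> //; split=> // i /H[|[]].
  by split=> //; split=> [|i /H]; left.
- by split=> [[_ [[|[]]]]|[]].
Qed.

Lemma segment_forestS :
  segment_forest n.+1 spoke link <->
  ~~ spoke 0 /\ (if link 0 then segment_forest n spoke' link'
                 else segment_tree n spoke' link').
Proof.
have -> : segment_forest n.+1 spoke link <->
  [/\ one_spoke n spoke' link' /\
      (spoke 0 -> link 0 -> ~ grounded n spoke' link' 0),
      ~ (spoke 0 \/ link 0 /\ grounded n spoke' link' 0)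
    & forall i, i <= n -> (grounded n spoke' link' i \/
     [/\ spoke 0, link 0 & joined link' 0 i]) \/ (link 0 /\ joined link' 0 i)].
  split=> -[os ng H]; split.
  - exact/one_spokeS.
  - by move=> g; apply/ng/grounded0S.
  - by move=> i ilen; rewrite -groundedSS -joined0S; apply: H.
  - exact/one_spokeS.
  - by move=> g; apply/ng/grounded0S.
  - case=> [|i] ilen; first by right; apply: joined_refl.
    by rewrite groundedSS joined0S; apply: H.
case: (link 0); case: (spoke 0) => /=.
- by split=> [[_ []]|[]//]; left.
- split=> [[[os _] ng H]|[_ [os ng H]]].
    split=> //; split=> // [g|i /H[[|[]]|[]]] //; [|by left|by right].
    by apply: ng; right.
  by split=> // [[//|[_ /ng]]|i /H[]]//; [left; left | right].
- by split=> [[_ []]|[]//]; left.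
- split=> [[[os _] ng H]|[_ [os H]]].
    by split=> //; split=> // i /H[[|[]]|[]].
  by split=> // [[//|[]]|i /H]//; left; left.
Qed.

End Step.

(** * Spanning trees of a fan *)

(** A simple cycle of length at least 3 leaves each of its vertices v and comes
    back to it through two different neighbours, which are connected by a path
    avoiding v. *)
Lemma ucycle_corner (V : finType) (e : rel V) (c : seq V) (v : V) :
  ucycle e c -> 2 < size c -> v \in c ->
  exists x p, [/\ e v x && e (last x p) v, path e x p, x != last x p,
    v \notin x :: p & {subset x :: p <= c}].
Proof.
move=> /andP[cyc_c uniq_c] sz_c vc.
have [k s def_s] := rot_to vc.
have : cycle e (v :: s) by rewrite -def_s rot_cycle.
have : uniq (v :: s) by rewrite -def_s rot_uniq.
have sub_s : {subset s <= c}.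
  by move=> x xs; rewrite -(mem_rot k) def_s inE xs orbT.
have : 2 < size (v :: s) by rewrite -def_s size_rot.
case: s sub_s {def_s} => [//|x [//|y p]] sub_s _ /and3P[vs xs _].
rewrite [cycle _ _]/= rcons_path => /and4P[vx xy yp pv].
exists x, (y :: p); split; rewrite /= ?vx ?xy //.
by apply: contraNneq xs => ->; apply: mem_last.
Qed.

Definition fan_rel n (spoke link : nat -> bool) : rel (option 'I_n.+1) :=
  fun x y => match x, y with
  | None, None => false
  | None, Some i => spoke i
  | Some i, None => spoke i
  | Some i, Some j => (i.+1 == j) && link i || (j.+1 == i) && link j
  end.

Section Fan.
Variables (n : nat) (spoke link : nat -> bool).
Local Notation e := (@fan_rel n spoke link).
Local Notation rim k := (Some (inord k) : option 'I_n.+1).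

Lemma fan_sym : symmetric e.
Proof. by case=> [i|] [j|] //=; rewrite orbC. Qed.

Lemma fan_irrefl : irreflexive e.
Proof. by case=> [i|] //=; rewrite gtn_eqF. Qed.

Lemma rimE (i : 'I_n.+1) : Some i = rim i.
Proof. by rewrite inord_val. Qed.

Lemma rim_spoke k : k <= n -> e None (rim k) = spoke k.
Proof. by move=> kn /=; rewrite inordK. Qed.

Lemma rim_link k : k < n -> e (rim k) (rim k.+1) = link k.
Proof.
by move=> kn /=; rewrite !inordK ?ltnS // 1?ltnW // eqxx gtn_eqF ?orbF.
Qed.

Lemma fan_path_rim i d : linked link i (i + d) -> i + d <= n ->
  path e (rim i) [seq rim k | k <- iota i.+1 d].
Proof.
elim: d i => // d IHd i lk le_n; apply/andP; split.
  by rewrite rim_link ?lk //; lia.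
apply: IHd; last by lia.
by rewrite addSnnS => k ik; apply: lk; lia.
Qed.

Lemma last_rim i d : last (rim i) [seq rim k | k <- iota i.+1 d] = rim (i + d).
Proof. by elim: d i => [|d IHd] i /=; rewrite ?addn0 // IHd addSnnS. Qed.

(** Away from the hub, a path can only use links, all of which must then be
    present between its two ends. *)
Lemma fan_path_joined (i : 'I_n.+1) p : path e (Some i) p -> None \notin p ->
  exists2 j : 'I_n.+1, last (Some i) p = Some j & joined link i j.
Proof.
elim: p i => [|[j|] p IHp] i; last by rewrite inE.
  by move=> _ _; exists i => //; apply: joined_refl.
rewrite inE /= => /andP[ij jp] /(IHp _ jp)[k -> jk]; exists k => //.
apply: joined_trans jk.
case/orP: ij => /andP[/eqP <-] /joinedS // /joined_sym //.
Qed.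

Lemma fan_connect_joined i j : i <= n -> j <= n -> joined link i j ->
  connect e (rim i) (rim j).
Proof.
wlog ij : i j / i <= j => [H|] ilen jlen [lij lji].
  case: (leqP i j) => [|/ltnW] ij; first exact: H.
  by rewrite (sym_connect_sym fan_sym); apply: H.
apply/connectP; exists [seq rim k | k <- iota i.+1 (j - i)].
  by apply: fan_path_rim; rewrite subnKC.
by rewrite last_rim subnKC.
Qed.

(** A segment without a spoke cannot be left; conversely a spoke connects its
    whole segment to the hub. *)
Lemma fan_connected :
  (forall x y, connect e x y) <->
  (forall i, i <= n -> grounded n spoke link i).
Proof.
split=> [conn i ilen|gr].
  have gr (k : 'I_n.+1) p :
    path e (Some k) p -> last (Some k) p = None -> grounded n spoke link k.
    elim: p k => [|[j|] p IHp] k //=.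
      case/andP=> kj jp /(IHp _ jp); apply: grounded_joined.
      by case/orP: kj => /andP[/eqP <-] /joinedS // /joined_sym.
    case/andP=> sk _ _; exists k; split=> //; first by rewrite -ltnS.
    exact: joined_refl.
  have /connectP[p rp lastp] := conn (rim i) None.
  by have := gr (inord i) p rp (esym lastp); rewrite inordK.
have hub i : i <= n -> connect e (rim i) None.
  move=> ilen; have [j [jn sj ij]] := gr _ ilen.
  apply: (connect_trans (fan_connect_joined ilen jn ij)).
  by apply: connect1; rewrite fan_sym rim_spoke.
have hub' x : connect e x None.
  by case: x => [i|]; [rewrite rimE; apply: hub; rewrite -ltnS | apply: connect0].
move=> x y; apply: (connect_trans (hub' x)).
by rewrite (sym_connect_sym fan_sym).
Qed.

(** Two spokes on a segment close a cycle through the hub.  Conversely, a cycle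
    through the hub leaves and enters it by two spokes on one segment, and a
    cycle that avoids the hub cannot exist: the two neighbours of its largest
    rim vertex i would both be i-1. *)
Lemma fan_acyclic :
  (forall c, ucycle e c -> size c < 3) <-> one_spoke n spoke link.
Proof.
split=> [acyc i j /andP[ij jn] si sj lij|os c ucyc].
  pose d := j - i.
  have := acyc (None :: [seq rim k | k <- iota i d.+1]).
  rewrite [size _]/= size_map size_iota.
  suff /[swap]/[apply] : ucycle e (None :: [seq rim k | k <- iota i d.+1]).
    by rewrite /d; lia.
  have idj : i + d = j by rewrite /d; lia.
  apply/andP; split.
    rewrite /cycle rcons_path; apply/andP; split.
      apply/andP; split; first by rewrite rim_spoke //; lia.
      by apply: fan_path_rim; rewrite idj.
    by rewrite [last _ _]/= last_rim idj fan_sym rim_spoke.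
  rewrite cons_uniq; apply/andP; split; first by apply/mapP => -[].
  rewrite map_inj_in_uniq ?iota_uniq // => k l.
  rewrite !mem_iota => kj lj [] /(congr1 (@nat_of_ord _)).
  by rewrite !inordK //; lia.
rewrite ltnNge; apply/negP => sz_c.
(* The corner of the cycle is taken at the hub if the cycle meets it, and at
   the largest rim vertex otherwise. *)
have [Nc|Nc] := boolP (None \in c).
  have [[i|] [p []]] // := ucycle_corner ucyc sz_c Nc.
  rewrite inE => /andP[si lastp] ip neq /norP[_ Np] _.
  have [j def_j [ij ji]] := fan_path_joined ip Np.
  move: lastp neq; rewrite def_j => sj.
  have [lt|lt|/val_inj ->] := ltngtP i j; last by rewrite eqxx.
    by case: (os i j) => //; rewrite lt -ltnS ltn_ord.
  by case: (os j i) => //; rewrite lt -ltnS ltn_ord.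
have [i0 i0c] : exists i, Some i \in c.
  case: c Nc sz_c {ucyc} => // -[i|] c; last by rewrite inE.
  by exists i; rewrite inE eqxx.
have [i ic imax] := @arg_maxnP _ i0 (fun i => Some i \in c) (@nat_of_ord _) i0c.
have [[j|] [p []]] := ucycle_corner ucyc sz_c ic; last first.
  by move=> _ _ _ _ /(_ None); rewrite inE eqxx (negPf Nc) => /(_ isT).
move=> /andP[ij lastp] jp neq _ sub_c.
have := sub_c _ (mem_last _ _); move: lastp neq.
have jc : Some j \in c by apply: sub_c; rewrite inE eqxx.
case: (last _ _) => [k|]; last by rewrite (negPf Nc).
move: ij; rewrite /=.
have := imax j jc => lej eij eki njk kc.
have := imax k kc => lek.
case/eqP: njk; congr Some; apply: val_inj => /=.
move: eij eki; lia.
Qed.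

Definition fan_graph : sgraph := SGraph fan_sym fan_irrefl.

Lemma edges_fan : edges fan_graph = edge_set e.
Proof. by []. Qed.

End Fan.

Lemma fan_spanning_tree n spoke link spoke' link' :
  (forall x y, @fan_rel n spoke' link' x y -> @fan_rel n spoke link x y) ->
  @spanning_tree (@fan_graph n spoke link) (edge_set (@fan_rel n spoke' link'))
  <-> segment_tree n spoke' link'.
Proof.
move=> sub; set T : {set {set fan_graph n spoke link}} := edge_set _.
have eT : edge_rel T = @fan_rel n spoke' link'.
  by apply/funext => x; apply/funext => y; apply/mem_edge_set/fan_sym.
rewrite /segment_tree -fan_connected -(fan_acyclic n) -eT.
split=> [[]|[]] //; split=> //.
apply/fintype.subsetP => _ /imsetP[[x y]] /[!inE] xy ->.
by apply/imsetP; exists (x, y) => //; rewrite inE; apply: sub.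
Qed.

(** * Counting the spanning trees of a fan *)

(** A set of edges of a fan with rim 0, ..., n, as the word of the pairs
    (spoke at i, link from i to i+1) for i < n, together with the bit of the
    spoke at n, where no further link exists.  The last bit is the default value
    of [spoke_of], which therefore is correct at i = n. *)
Definition subfan : Type := bool * seq (bool * bool).
Definition spoke_of (w : subfan) i := nth w.1 (unzip1 w.2) i.
Definition link_of (w : subfan) i := nth false (unzip2 w.2) i.

Definition is_tree (w : subfan) :=
  `[< segment_tree (size w.2) (spoke_of w) (link_of w) >].
Definition is_forest (w : subfan) :=
  `[< segment_forest (size w.2) (spoke_of w) (link_of w) >].

Lemma is_tree_nil s : is_tree (s, [::]) = s.
Proof.
apply/asboolP/idP => [[_ /(_ 0 isT)] [[|j] []]//|sT]; split=> [i j /= ij|[|i] //].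
  by lia.
by exists 0; split=> //; apply: joined_refl.
Qed.

Lemma is_forest_nil s : is_forest (s, [::]) = ~~ s.
Proof.
apply/asboolP/idP => [[_ ng _]|sF].
  by apply/negP => sT; apply: ng; exists 0; split=> //; apply: joined_refl.
split=> [i j /= ij|[[|j] []] //= _|[|i] // _]; first by lia.
  by rewrite /spoke_of /= (negPf sF).
by right; apply: joined_refl.
Qed.

Lemma is_tree_cons s0 s l w : is_tree (s0, (s, l) :: w) =
  if l then if s then is_forest (s0, w) else is_tree (s0, w)
  else s && is_tree (s0, w).
Proof.
apply/asboolP/idP => [/segment_treeS|tr]; [|apply/segment_treeS; move: tr].
all: case: l; case: s => //=; try by move/asboolP.
- by case=> _ /asboolP.
- by case.
Qed.

Lemma is_forest_cons s0 s l w : is_forest (s0, (s, l) :: w) =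
  ~~ s && (if l then is_forest (s0, w) else is_tree (s0, w)).
Proof.
apply/asboolP/idP => [/segment_forestS[]|fo];
  [|apply/segment_forestS; move: fo]; case: s; case: l => //=.
- by move=> _ /asboolP.
- by move=> _ /asboolP.
- by move=> /asboolP fo; split.
- by move=> /asboolP fo; split.
Qed.

Definition letters (a : bool) : seq (bool * bool) :=
  [seq (s, l) | s <- if a then [:: true; false] else [:: false],
                l <- [:: true; false]].

(** P tells which rim vertices before the last one are adjacent to the hub of
    the whole fan; the last one always is. *)
Fixpoint subfans (P : seq bool) : seq subfan :=
  if P is a :: P' then
    [seq (w.1, x :: w.2) | x <- letters a, w <- subfans P']
  else [:: (true, [::]); (false, [::])].

Lemma mem_letters a x : (x \in letters a) = (x.1 ==> a).
Proof. by case: x a => -[] [] []. Qed.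

Lemma mem_subfans P w :
  (w \in subfans P) <->
  size w.2 = size P /\ (forall i, spoke_of w i -> nth true P i).
Proof.
elim: P w => [|a P IHP] [s0 w] /=.
  split=> [|[/size0nil /= -> _]]; last by case: s0.
  by rewrite !inE => /orP[] /eqP[-> ->]; split=> // i; rewrite nth_nil.
split=> [/allpairsP[[x [s1 w']]] /= [xa /IHP[sz sub] [-> ->]]|].
  split=> [|[|i]]; rewrite /= ?sz //; last exact: sub.
  by move: xa; rewrite mem_letters => /implyP.
case: w => [[]//|x w [] [sz] sub].
apply/allpairsP; exists (x, (s0, w)); split=> //=.
  by rewrite mem_letters; apply/implyP/(sub 0).
by apply/IHP; split=> // i; apply: (sub i.+1).
Qed.

Lemma subfans_uniq P : uniq (subfans P).
Proof.
elim: P => // a P IHP; apply: allpairs_uniq => //; first by case: a.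
by move=> [x [s w]] [y [s' w']] _ _ /= [-> -> ->].
Qed.

(** The numbers of spanning trees and of two-component spanning forests
    separating the hub from the rim vertex 0. *)
Fixpoint fan_counts (P : seq bool) : nat * nat :=
  if P is a :: P' then
    let: (t, f) := fan_counts P' in (t + a * (t + f), t + f)
  else (1, 1).

(** Of the choices at a new vertex, (no spoke, link) and, when a spoke is
    available, (spoke, no link) turn a tree into a tree, (spoke, link) turns a
    forest into a tree; (no spoke, link) keeps a forest, and (no spoke, no link)
    turns a tree into a forest. *)
Lemma count_subfans P :
  (count is_tree (subfans P), count is_forest (subfans P)) = fan_counts P.
Proof.
elim: P => [|a P IHP] /=.
  by rewrite !is_tree_nil !is_forest_nil.
rewrite -IHP.
have count0 (p : pred subfan) : p =1 pred0 -> count p (subfans P) = 0.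
  by move=> p0; rewrite (eq_count p0) count_pred0.
have tE x : count is_tree [seq (w.1, x :: w.2) | w <- subfans P] =
  if x.2 then if x.1 then count is_forest (subfans P)
              else count is_tree (subfans P)
  else x.1 * count is_tree (subfans P).
  rewrite count_map; case: x => [[] []] /=; rewrite ?mul1n ?mul0n.
  - by apply: eq_count => -[s w]; rewrite /= is_tree_cons.
  - by apply: eq_count => -[s w]; rewrite /= is_tree_cons.
  - by apply: eq_count => -[s w]; rewrite /= is_tree_cons.
  - by apply: count0 => -[s w]; rewrite /= is_tree_cons.
have fE x : count is_forest [seq (w.1, x :: w.2) | w <- subfans P] =
  ~~ x.1 * (if x.2 then count is_forest (subfans P)
            else count is_tree (subfans P)).
  rewrite count_map; case: x => [[] []] /=; rewrite ?mul1n ?mul0n.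
  - by apply: count0 => -[s w]; rewrite /= is_forest_cons.
  - by apply: count0 => -[s w]; rewrite /= is_forest_cons.
  - by apply: eq_count => -[s w]; rewrite /= is_forest_cons.
  - by apply: eq_count => -[s w]; rewrite /= is_forest_cons.
by case: a; rewrite /= !count_cat !tE !fE /=; congr (_, _); lia.
Qed.

Section Tau.
Variable P : seq bool.
Let n := size P.
Let G := @fan_graph n (nth true P) xpredT.

Definition subfan_edges (w : subfan) : {set {set G}} :=
  edge_set (@fan_rel n (spoke_of w) (link_of w)).

Lemma subfan_edges_inj : {in subfans P &, injective subfan_edges}.
Proof.
move=> [s1 w1] [s2 w2] /mem_subfans[/= sz1 _] /mem_subfans[/= sz2 _] E.
have relE x y : fan_rel (spoke_of (s1, w1)) (link_of (s1, w1)) x y =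
                @fan_rel n (spoke_of (s2, w2)) (link_of (s2, w2)) x y.
  have := congr1 (fun T : {set {set G}} => ([set x; y])%SET \in T) E.
  by rewrite !mem_edge_set //; apply: fan_sym.
have spE i : i <= n -> spoke_of (s1, w1) i = spoke_of (s2, w2) i.
  by move=> ilen; rewrite -(rim_spoke _ (link_of (s1, w1)) ilen) relE rim_spoke.
have lkE i : i < n -> link_of (s1, w1) i = link_of (s2, w2) i.
  by move=> ilen; rewrite -(rim_link (spoke_of (s1, w1)) _ ilen) relE rim_link.
have sE : s1 = s2.
  by have := spE n (leqnn n); rewrite /spoke_of !nth_default ?size_map ?sz1 ?sz2.
congr (_, _) => //; apply: (@eq_from_nth _ (s1, false)); rewrite sz1 ?sz2 // => i ilt.
have nthE (w : seq (bool * bool)) : size w = n ->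
  nth (s1, false) w i = (spoke_of (s1, w) i, link_of (s1, w) i).
  move=> szw; rewrite /spoke_of /link_of /=.
  by rewrite !(nth_map (s1, false)) ?szw //; case: nth.
by rewrite !nthE // (lkE _ ilt) (spE _ (ltnW ilt)) sE.
Qed.

Lemma tau_fan : tau G = (fan_counts P).1.
Proof.
rewrite -count_subfans /= -size_filter -(size_map subfan_edges).
have uT : uniq [seq subfan_edges w | w <- subfans P & is_tree w].
  rewrite map_inj_in_uniq ?filter_uniq ?subfans_uniq // => w1 w2.
  by rewrite !mem_filter => /andP[_ w1P] /andP[_ w2P]; apply: subfan_edges_inj.
rewrite /tau -(card_uniqP uT); apply: eq_card => T; rewrite inE.
apply/asboolP/mapP => [spT|[w]]; last first.
  rewrite mem_filter => /andP[/asboolP trw /mem_subfans[sz sub]] ->.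
  apply/fan_spanning_tree; last by move: trw; rewrite sz.
  move=> [i|] [j|] //=; [|exact: sub|exact: sub].
  by case/orP=> /andP[-> _]; rewrite ?orbT.
pose rim k : G := Some (inord k).
(* The word of a given spanning tree is read off from its membership bits. *)
pose w : subfan := (([set None; rim n])%SET \in T,
  mkseq (fun i => (([set None; rim i])%SET \in T,
                   ([set rim i; rim i.+1])%SET \in T)) n).
have [subT _ _] := spT.
have spE i : i <= n -> spoke_of w i = (([set None; rim i])%SET \in T).
  rewrite leq_eqVlt => /predU1P[->|ilt].
    by rewrite /spoke_of nth_default // size_map size_mkseq.
  by rewrite /spoke_of (nth_map (true, true)) ?nth_mkseq ?size_mkseq.
have lkE i : i < n -> link_of w i = (([set rim i; rim i.+1])%SET \in T).
  by move=> ilt; rewrite /link_of (nth_map (true, true)) ?nth_mkseq ?size_mkseq.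
have edgeT (x y : G) : ([set x; y])%SET \in T -> adj x y.
  by move/(fintype.subsetP subT); rewrite edges_fan mem_edge_set //; apply: fan_sym.
have relT (x y : G) :
    fan_rel (spoke_of w) (link_of w) x y = (([set x; y])%SET \in T).
  case: x y => [i|] [j|].
  - apply/idP/idP => [/orP[] /andP[/eqP ij]|].
    + rewrite lkE /rim; last by rewrite -ltnS ij ltn_ord.
      by rewrite ij !inord_val.
    + rewrite lkE /rim; last by rewrite -ltnS ij ltn_ord.
      by rewrite ij !inord_val finset.setUC.
    + move=> ijT; have /= := edgeT _ _ ijT; rewrite !andbT.
      case/orP=> /eqP ij; apply/orP; [left|right]; rewrite ij eqxx /=.
        by rewrite lkE /rim -1?ltnS ij ?ltn_ord // !inord_val.
      by rewrite lkE /rim -1?ltnS ij ?ltn_ord // !inord_val finset.setUC.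
  - by rewrite /= spE -1?ltnS // /rim inord_val finset.setUC.
  - by rewrite /= spE -1?ltnS // /rim inord_val.
  - by apply/esym/negP => /edgeT.
have wT : T = subfan_edges w.
  apply/setP => A; apply/idP/imsetP => [AT|[[x y]]]; last first.
    by rewrite inE relT => xyT ->.
  have /imsetP[[x y] _ /= def_A] := fintype.subsetP subT _ AT.
  by exists (x, y); rewrite // inE relT -def_A.
exists w => //; rewrite mem_filter; apply/andP; split.
  apply/asboolP; rewrite size_mkseq.
  apply/(@fan_spanning_tree n (nth true P) xpredT); last first.
    by rewrite -[edge_set _]/(subfan_edges w) -wT.
  by move=> x y; rewrite relT => /edgeT.
apply/mem_subfans; split; first by rewrite size_mkseq.
move=> i; case: (ltnP i n) => [ilt|nle _]; last by rewrite nth_default.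
rewrite spE ?(ltnW ilt) // => /(fintype.subsetP subT).
rewrite edges_fan mem_edge_set ?rim_spoke ?(ltnW ilt) //; exact: fan_sym.
Qed.
End Tau.

(** * Continued fractions whose even partial quotients are 1 *)

(** Numerator and denominator of 1 / (b + 1 / (1 + p / q)), not simplified. *)
Definition cfrac_step (b : nat) (pq : nat * nat) : nat * nat :=
  let: (p, q) := pq in (p + q, b * (p + q) + q).

Definition cfrac_pair : seq nat -> nat * nat := foldr cfrac_step (0, 1).

Lemma cfrac_pair_gt0 s : 0 < (cfrac_pair s).2.
Proof. by elim: s => //= b s; case: (cfrac_pair s) => p q /=; lia. Qed.

Lemma cfrac_pair_coprime s : coprime (cfrac_pair s).1 (cfrac_pair s).2.
Proof.
elim: s => //= b s; case: (cfrac_pair s) => p q /=.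
by rewrite /coprime gcdnMDl [gcdn (_ + _) _]gcdnC gcdnDr gcdnC.
Qed.

Lemma cfracE s : cfrac (flatten [seq [:: b; 1] | b <- s]) =
  ((cfrac_pair s).1%:R / (cfrac_pair s).2%:R)%R.
Proof.
elim: s => [|b s IHs] /=; first by rewrite mul0r.
rewrite IHs; have := cfrac_pair_gt0 s; case: (cfrac_pair s) => p q /= q0.
rewrite !(natrD, natrM).
have q0' : (0 < q%:R :> rat)%R by rewrite ltr0n.
have p0 : (0 <= p%:R :> rat)%R by rewrite ler0n.
have b0 : (0 <= b%:R :> rat)%R by rewrite ler0n.
have bpq : (0 <= b%:R * (p%:R + q%:R) :> rat)%R by rewrite mulr_ge0 // addr_ge0 // ltW.
by field; rewrite ?gt_eqF //; nra.
Qed.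

(** The rim starts with the newest vertices, so in each block of b vertices the
    one that is joined to the hub, added last, comes first. *)
Definition blocks (s : seq nat) : seq bool :=
  flatten [seq true :: nseq b.-1 false | b <- s].

Lemma size_blocks s : all (leq 1) s -> size (blocks s) = sumn s.
Proof.
elim: s => //= b s IHs /andP[b0 /IHs]; rewrite size_cat size_nseq => ->; lia.
Qed.

(** A block of b vertices turns (t, f) into (t + (f + b t), f + b t): its b
    vertices each add t to f, and the spoke closing the block adds the new f
    to t.  For t = p + q and f = q this is [cfrac_step]. *)
Lemma fan_counts_blocks s : all (leq 1) s ->
  fan_counts (blocks s) = ((cfrac_pair s).1 + (cfrac_pair s).2, (cfrac_pair s).2).
Proof.
have nseqE b P : fan_counts (nseq b false ++ P) =
    ((fan_counts P).1, (fan_counts P).2 + b * (fan_counts P).1).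
  elim: b => [|b IHb] /=; first by case: fan_counts => t f /=; rewrite addn0.
  by rewrite IHb; case: fan_counts => t f /=; congr (_, _); lia.
elim: s => //= b s IHs /andP[b0 /IHs]; rewrite nseqE /blocks => ->.
by case: (cfrac_pair s) => p q /=; congr (_, _); nia.
Qed.

Lemma eq_fraction (a b c d : nat) : 0 < b -> 0 < d ->
  coprime a b -> coprime c d -> (a%:R / b%:R = c%:R / d%:R :> rat)%R -> a = c.
Proof.
move=> b0 d0 cab ccd /eqP.
rewrite eqr_div ?pnatr_eq0 -?lt0n // -!natrM eqr_nat => /eqP E.
apply/eqP; rewrite eqn_dvd -(@Gauss_dvdl _ _ _ cab) -E dvdn_mulr //=.
by rewrite -(@Gauss_dvdl _ _ _ ccd) E dvdn_mulr.
Qed.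

(** * A straight-line drawing of a fan *)

Section Drawing.
Variables (R : realType) (n : nat) (spoke link : nat -> bool).
Local Open Scope ring_scope.
Local Open Scope classical_set_scope.
Let G := @fan_graph n spoke link.

Definition line (p q : R * R) (s : R) : R * R :=
  (p.1 + s * (q.1 - p.1), p.2 + s * (q.2 - p.2)).

Definition segment (p q : R * R) : set (R * R) := line p q @` `[0, 1].

Lemma segment_arc p q : p <> q -> is_arc (segment p q) p q.
Proof.
move=> pq; exists (line p q); split => //.
- apply: continuous_subspaceT => x.
  have affine (a b : R) : continuous (fun s : R => a + s * b).
    move=> s; apply: cvgD; first exact: cvg_cst.
    by apply: cvgM; [exact: cvg_id | exact: cvg_cst].
  exact: (cvg_pair (affine _ _ x) (affine _ _ x)).
- move=> s t _ _ [] /addrI st1 /addrI st2; apply/eqP; apply: contra_notT pq => nst.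
  move: st1 st2 => /eqP; rewrite -subr_eq0 -mulrBl mulf_eq0 subr_eq0 (negPf nst).
  move=> /= /eqP d1 /eqP; rewrite -subr_eq0 -mulrBl mulf_eq0 subr_eq0 (negPf nst).
  move=> /= /eqP d2; case: p q d1 d2 => [a b] [c d] /=.
  by move=> /eqP; rewrite subr_eq0 => /eqP-> /eqP; rewrite subr_eq0 => /eqP->.
- by case: p {pq} => a b; rewrite /line !mul0r !addr0.
- by case: q {pq} => a b; rewrite /line !mul1r !subrKC.
Qed.

Lemma segmentC p q : segment p q = segment q p.
Proof.
suff sub a b : segment a b `<=` segment b a by apply/seteqP; split; apply: sub.
move=> _ [s /= s01 <-]; exists (1 - s) => /=.
  by move: s01; rewrite !in_itv /=; lra.
by rewrite /line; congr (_, _); ring.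
Qed.

Lemma segment_left p q : segment p q p.
Proof.
exists 0; first by rewrite /= in_itv /=; lra.
by case: p => a b; rewrite /line !mul0r !addr0.
Qed.

Definition position (v : G) : R * R :=
  if v is Some i then (i%:R, 0) else (0, 1).

(** For an edge {x, y} the choices x = y only contribute the end points, so this
    is the segment between the two ends, independently of their order. *)
Definition drawing (e : {set G}) : set (R * R) :=
  [set z | exists x y, [/\ x \in e, y \in e & segment (position x) (position y) z]].

Lemma position_inj : injective position.
Proof.
move=> [i|] [j|] //=.
- by case=> /eqP; rewrite eqr_nat => /eqP /val_inj ->.
- by case=> _ /eqP; rewrite eq_sym oner_eq0.
- by case=> _ /eqP; rewrite oner_eq0.
Qed.

Lemma drawing_edge (x y : G) :
  drawing [set x; y]%SET = segment (position x) (position y).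
Proof.
apply/seteqP; split => z; last first.
  by move=> xyz; exists x, y; split; rewrite ?inE ?eqxx ?orbT.
have deg (v w : G) : segment (position v) (position v) z ->
    segment (position v) (position w) z.
  case=> s _ <-; suff -> : line (position v) (position v) s = position v.
    exact: segment_left.
  by case: (position v) => a b; rewrite /line /= !subrr !mulr0 !addr0.
case=> a [b []]; rewrite !inE => /orP[] /eqP-> /orP[] /eqP-> //.
- exact: deg.
- by rewrite segmentC.
- by move/(deg y x); rewrite segmentC.
Qed.

Lemma drawing_spoke (i : 'I_n.+1) z : drawing [set (None : G); Some i]%SET z ->
  exists2 s : R, 0 <= s <= 1 & z = (s * i%:R, 1 - s).
Proof.
rewrite drawing_edge => -[s /=]; rewrite in_itv /= => s01 <-; exists s => //.
by rewrite /line /=; congr (_, _); ring.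
Qed.

Lemma drawing_link (i j : 'I_n.+1) z : i.+1 = j ->
  drawing [set (Some i : G); Some j]%SET z ->
  exists2 s : R, 0 <= s <= 1 & z = (i%:R + s, 0).
Proof.
move=> ij; rewrite drawing_edge => -[s /=]; rewrite in_itv /= => s01 <-.
by exists s => //; rewrite /line /= -ij -natr1; congr (_, _); ring.
Qed.

Lemma fan_edgeP (e : {set G}) : e \in edges G ->
  (exists i : 'I_n.+1, e = [set (None : G); Some i]%SET) \/
  (exists i j : 'I_n.+1, i.+1 = j /\ e = [set (Some i : G); Some j]%SET).
Proof.
case/imsetP=> -[[i|] [j|]] /=; rewrite inE //=; last first.
- by move=> _ ->; left; exists j.
- by move=> _ ->; left; exists i; rewrite finset.setUC.
case/orP=> /andP[/eqP ij _] ->; right; first by exists i, j.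
by exists j, i; rewrite finset.setUC.
Qed.

(** The rim lies on the horizontal axis, which a spoke meets only at its foot. *)
Lemma spoke_meets_link (i j k : 'I_n.+1) z : j.+1 = k ->
  drawing [set (None : G); Some i]%SET z ->
  drawing [set (Some j : G); Some k]%SET z ->
  z = position (Some i) /\ (i = j \/ i = k).
Proof.
move=> jk /drawing_spoke[s s01 ->] /(drawing_link jk)[r r01] [E s1].
have {}s1 : s = 1 by lra.
move: E; rewrite s1 mul1r => E; split; first by rewrite /= subrr.
have ji : (j <= i)%N by rewrite -(ler_nat R) E; lra.
have ik : (i <= k)%N by rewrite -(ler_nat R) E -jk -natr1; lra.
by case: (ltngtP j i) ji => // [ltji _|/val_inj ->]; [right; apply: val_inj => /=; lia | left].
Qed.

Lemma fan_planar : planar R G.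
Proof.
exists position, drawing; split; first exact: position_inj.
- move=> x y xy; rewrite drawing_edge; apply: segment_arc => /position_inj E.
  by move: xy; rewrite E (adj_irrefl y).
- move=> e v /fan_edgeP[[i ->]|[i [j [ij ->]]]].
    case/drawing_spoke=> s s01; case: v => [k|] /= [].
      move=> ks s1; have {}s1 : s = 1 by lra.
      move: ks; rewrite s1 mul1r => /eqP; rewrite eqr_nat => /eqP /val_inj ->.
      by rewrite !inE eqxx orbT.
    by rewrite !inE.
  case/(drawing_link ij)=> s s01; case: v => [k|] /= []; last first.
    by move=> _ /eqP; rewrite oner_eq0.
  move=> E; have ik : (i <= k)%N by rewrite -(ler_nat R) E; lra.
  have kj : (k <= j)%N by rewrite -(ler_nat R) E -ij -natr1; lra.
  rewrite !inE; case: (ltngtP i k) ik => // [ltik _|/val_inj ->]; last first.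
    by rewrite eqxx.
  by apply/orP; right; apply/eqP; congr Some; apply: val_inj => /=; lia.
move=> e f /fan_edgeP[[i ->]|[i [i' [ii' ->]]]] /fan_edgeP[[j ->]|[j [j' [jj' ->]]]].
- move=> ne z /drawing_spoke[s s01 ->] /drawing_spoke[r r01] [E sr].
  have {}sr : s = r by lra.
  exists None; rewrite !inE eqxx; split=> //=.
  have : s * (i%:R - j%:R) = 0 by rewrite mulrBr E sr subrr.
  move/eqP; rewrite mulf_eq0 => /orP[/eqP ->|]; first by rewrite mul0r subr0.
  by rewrite subr_eq0 eqr_nat => /eqP /val_inj ij; rewrite ij eqxx in ne.
- move=> _ z zi zj; have [-> iE] := spoke_meets_link jj' zi zj.
  by exists (Some i); rewrite !inE eqxx orbT; split=> //; case: iE => ->; rewrite eqxx ?orbT.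
- move=> _ z zi zj; have [-> jE] := spoke_meets_link ii' zj zi.
  by exists (Some j); rewrite !inE eqxx orbT; split=> //; case: jE => ->; rewrite eqxx ?orbT.
- wlog ltij : i i' ii' j j' jj' / (i < j)%N => [H|].
    move=> ne z zi zj; case: (ltngtP i j) => [lt|lt|/val_inj ij].
    + exact: (H i i' ii' j j' jj').
    + have [|v [vj vi zv]] := H j j' jj' i i' ii' lt _ z zj zi; last by exists v.
      by rewrite eq_sym.
    + case/eqP: ne; rewrite ij; congr [set _; Some _]%SET; apply: val_inj.
      by rewrite /= -ii' -jj' ij.
  move=> _ z /(drawing_link ii')[s s01 ->] /(drawing_link jj')[r r01] [E].
  have ji' : (j <= i')%N by rewrite -(ler_nat R) -ii' -natr1; lra.
  have i'j : i' = j by apply: val_inj => /=; lia.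
  exists (Some j); rewrite !inE i'j eqxx orbT; split=> //=.
  have : j%:R = i%:R + 1 :> R by rewrite -i'j -ii' natr1.
  by move=> jE; congr (_, _); lra.
Qed.

End Drawing.

(** * The graph of a continued fraction *)

Local Open Scope ring_scope.

Theorem theorem1p9 (R : realType) (t u : nat) (t_gt0 : (1 <= t)%N)
    (u_gt0 : (1 <= u)%N) (lt_tu : (t < u)%N) (cop_tu : gcdn t u = 1%N)
    (m : nat) (m_gt0 : (1 <= m)%N) (b : nat -> nat)
    (b_gt0 : forall i : nat, (1 <= i <= m)%N -> (1 <= b i)%N)
    (tu_cfrac : t%:R / u%:R
       = cfrac (flatten [seq [:: b i; 1%N] | i <- iota 1 m])) :
  exists G : sgraph,
    [/\ planar R G, tau G = t
      & #|G| = (\sum_(2 <= i < m.+1) b i + 2)%N].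
Proof.
case: m m_gt0 b_gt0 tu_cfrac => // m _ b_gt0 tu_cfrac.
pose s := [seq b i | i <- iota 2 m].
have s_gt0 : all (leq 1) s.
  by apply/allP => _ /mapP[i i2m ->]; apply: b_gt0; move: i2m; rewrite mem_iota; lia.
have tE : t = ((cfrac_pair s).1 + (cfrac_pair s).2)%N.
  (* The first partial quotient only affects the denominator. *)
  have -> : ((cfrac_pair s).1 + (cfrac_pair s).2)%N = (cfrac_pair (b 1%N :: s)).1.
    by rewrite /=; case: cfrac_pair.
  apply: (eq_fraction u_gt0 (cfrac_pair_gt0 (b 1%N :: s)) _ (cfrac_pair_coprime _)).
    exact/eqP.
  by rewrite -cfracE tu_cfrac /= -map_comp.
exists (@fan_graph (size (blocks s)) (nth true (blocks s)) xpredT); split.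
- exact: fan_planar.
- by rewrite tau_fan fan_counts_blocks.
rewrite card_option card_ord size_blocks // sumnE big_map addn2.
by rewrite /index_iota subSS subn1.
Qed.
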